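(* Let $a,b,c$ be generic real parameters and $d$ a further free parameter. Let $X_1,X_3,L_1,L_3,L$ be the differential operators in two variables $x,y$ given in the context, which satisfy the defining relations of the rank two Jacobi algebra $\mathfrak J_2$ (the differential model of $\mathfrak J_2$). With $[A,B]=AB-BA$ and $\{A,B\}=AB+BA$, define $$C_{23}=-L_1+\tfrac{(b+c+1)^2-1}{4},\qquad C_{34}=-L_3+\tfrac{(a+b+1)^2-1}{4},\qquad C_{234}=-L+\tfrac{(a+b+c+2)^2-1}{4},$$ $$C_{123}=\tfrac{a+d+2}{2}[X_1,C_{234}]-\tfrac12\{X_1,C_{234}\}-\tfrac{(a+d+2)^2-(d-b-c)^2}{4}X_1+\tfrac{a^2+(a+d+2)^2-2}{4},$$ $$C_{12}=-\tfrac{a+d+2}{2}[X_3,C_{234}]+\tfrac12\{X_3-1,C_{234}\}+\tfrac{(a+d+2)^2-(d-b-c)^2}{4}(X_3-1)+C_{34}+\tfrac{(a+d+2)^2-1}{4}.$$ Then the five generators $C_{12},C_{23},C_{34},C_{123},C_{234}$ satisfy all the defining relations (i), (ii), (iii) of the rank two Racah algebra $\mathfrak R_2$ listed in the context, with the central elements taking the values $$C_1=\tfrac{(d-b-c)^2-1}{4},\quad C_2=\tfrac{c^2-1}{4},\quad C_3=\tfrac{b^2-1}{4},\quad C_4=\tfrac{a^2-1}{4},\quad C_{1234}=\tfrac{(a+d+2)^2-1}{4}.$$ From this construction one obtains a differential realization of the rank two Racah algebra $\mathfrak R_2$ and an embedding of this algebra inside the rank two Jacobi algebra $\mathfrak 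J_2$.
   Context: **Differential model.** With $\partial_x=\partial/\partial x$, $\partial_y=\partial/\partial y$, where $X_1,X_3$ act by multiplication and scalars stand for multiples of the identity $I$: $$X_1=x,\qquad X_3=1-x-y,$$ $$L_1=y(1-x-y)\partial_y^2+\bigl((b+1)(1-x)-(b+c+2)y\bigr)\partial_y,$$ $$L_3=xy(\partial_x^2+\partial_y^2-2\partial_x\partial_y)+\bigl((a+1)y-(b+1)x\bigr)(\partial_x-\partial_y),$$ $$L=x(1-x)\partial_x^2+y(1-y)\partial_y^2-2xy\,\partial_x\partial_y+(a+1-(a+b+c+3)x)\partial_x+(b+1-(a+b+c+3)y)\partial_y.$$ **Defining relations of $\mathfrak J_2$.** It is generated by $L,L_1,L_3,X_1,X_3$ subject to $$[L,L_1]=[L,L_3]=[L_1,X_1]=[L_3,X_3]=[X_1,X_3]=0,$$ $$[[L,X_1],L]=2\{X_1,L\}-2L+2L_1-(a+b+c+1)((a+b+c+3)X_1-(a+1)I),\quad [[L,X_1],L_1]=0,$$ $$[[L,X_1],L_3]=\{X_1,L+L_3\}+\{X_3-I,L-L_1\}-(a+b+c+1)\bigl((a+1)(X_1+X_3-I)+(b+1)X_1\bigr),$$ $$[[L,X_1],X_1]=-2X_1^2+2X_1,\quad [[L,X_1],X_3]=-2X_1X_3,$$ $$[[L,X_3],L]=2\{X_3,L\}-2L+2L_3-(a+b+c+1)((a+b+c+3)X_3-(c+1)I),$$ $$[[L,X_3],L_1]=\{X_1-I,L-L_3\}+\{X_3,L+L_1\}-(a+b+c+1)\bigl((c+1)(X_1+X_3-I)+(b+1)X_3\bigr),$$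 $$[[L,X_3],L_3]=0,\quad [[L,X_3],X_1]=[[L,X_1],X_3],\quad [[L,X_3],X_3]=-2X_3^2+2X_3,$$ $$[[L_1,L_3],L]=0,$$ $$[[L_1,L_3],L_1]=2\{L_1,L_3\}+2L_1^2-2L_1L+(b+c)(b+1)(L-L_1-L_3)-(b+c)(c+1)L_3-(b-c)(a+1)L_1,$$ $$[[L_1,L_3],L_3]=-2\{L_1,L_3\}-2L_3^2+2L_3L-(a+b)(b+1)(L-L_1-L_3)+(a+b)(a+1)L_1+(b-a)(c+1)L_3,$$ $$[[L_1,L_3],X_1]=-\{X_1-I,L-L_1-L_3\}-\{X_3,L-L_1\}+(a+1)\bigl((b+1)X_3+(c+1)(X_1+X_3-I)\bigr),$$ $$[[L_1,L_3],X_3]=\{X_1,L-L_3\}+\{X_3-I,L-L_1-L_3\}-(c+1)\bigl((a+1)(X_1+X_3-I)+(b+1)X_1\bigr),$$ $$[[L_1,X_3],L]=[[L,X_3],L_1],\quad [[L_1,X_3],L_3]=[[L_1,L_3],X_3],\quad [[L_1,X_3],X_1]=0,$$ $$[[L_1,X_3],L_1]=2\{X_3,L_1\}+\{X_1,L_1\}-2L_1-(b+c)\bigl((b+c+2)X_3-(c+1)(I-X_1)\bigr),$$ $$[[L_1,X_3],X_3]=-2X_3^2+2(I-X_1)X_3,$$ $$[[L_3,X_1],L]=[[L,X_1],L_3],\quad [[L_3,X_1],L_1]=-[[L_1,L_3],X_1],\quad [[L_3,X_1],X_3]=0,$$ $$[[L_3,X_1],L_3]=\{2X_1+X_3-I,L_3\}-(a+b)\bigl((a+1)(X_1+X_3-I)+(b+1)X_1\bigr),$$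 $$[[L_3,X_1],X_1]=-2X_1(X_1+X_3-I).$$ **Defining relations of $\mathfrak R_2$.** It is generated by $C_{12},C_{23},C_{34},C_{123},C_{234}$ and central elements $C_1,C_2,C_3,C_4,C_{1234}$ subject to: (i) Commutativity: $[C_{12},C_{34}]=[C_{12},C_{123}]=[C_{23},C_{123}]=[C_{23},C_{234}]=[C_{34},C_{234}]=0$. (ii) $\mathfrak R_1$-type relations. A couple $(K,M)$ satisfies the rank one Racah relations with parameters $(c_1,c_2,c_3,c_{123})$ (elements commuting with $K$ and $M$) if $$[K,[K,M]]=2\{K,M\}+2K^2-2(c_1+c_2+c_3+c_{123})K-2(c_1-c_2)(c_3-c_{123}),$$ $$[M,[M,K]]=2\{K,M\}+2M^2-2(c_1+c_2+c_3+c_{123})M-2(c_1-c_{123})(c_3-c_2).$$ The couples $(C_{12},C_{23})$, $(C_{23},C_{34})$, $(C_{123},C_{34})$, $(C_{234},C_{123})$, $(C_{234},C_{12})$ satisfy these with $(c_1,c_2,c_3,c_{123})$ equal respectively to $(C_1,C_2,C_3,C_{123})$, $(C_2,C_3,C_4,C_{234})$, $(C_{12},C_3,C_4,C_{1234})$, $(C_4,C_{23},C_1,C_{1234})$, $(C_2,C_{34},C_{1234},C_1)$. (iii) $\mathfrak R_2$-type relations: $$[C_{12},C_{23}]+[C_{23},C_{34}]-[C_{123},C_{34}]-[C_{12},C_{234}]+[C_{123},C_{234}]=0,$$ $$\tfrac12[C_{34},[C_{12},C_{23}]]=C_{12}(C_{23}+C_{34}-C_{234}-C_3)+C_{23}(C_{34}-C_{1234})-C_{34}C_2+C_{123}(C_{234}-C_{34}-C_2)-C_{234}C_3+(C_2+C_3)C_{1234}+C_2C_3,$$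 $$\tfrac12[C_{23},[C_{123},C_{34}]]=C_{12}(-C_{23}+C_{234}-C_4)+C_{23}(C_{123}-C_4)+C_{34}(C_{23}-C_1)+C_{123}(C_{34}-C_{234}-C_3)-C_{234}C_3+(C_1+C_3)C_4+C_1C_3,$$ $$\tfrac12[C_{234},[C_{23},C_{12}]]=C_{12}(C_{234}-C_4)+C_{23}(C_{12}-C_{34}+C_{234}-C_1)-C_{34}C_1+C_{123}(C_{34}-C_{234}-C_2)-C_{234}C_2+(C_1+C_2)C_4+C_1C_2,$$ $$\tfrac12[C_{234},[C_{123},C_{34}]]=C_{12}(-C_{23}+C_{234}+C_4)+C_{34}(C_{23}-C_{123}-C_{234}+C_{1234})+C_{23}C_{1234}+C_{123}(-C_{234}+C_2)+C_{234}C_4-(C_2+C_{1234})C_4-C_2C_{1234},$$ $$(C_{12}+C_{234}-C_2-C_{1234})[C_{12},C_{23}]+(C_{12}-C_2+C_1)[C_{23},C_{34}]+(C_{123}-C_{23}-C_{12}+C_2)[C_{12},C_{234}]+(C_{12}-C_2-C_1)[C_{34},C_{123}]=0,$$ $$(-C_{234}+C_{34}+C_2)[C_{12},C_{23}]+(C_{12}-C_1+C_2)[C_{23},C_{34}]+(C_{23}-C_2-C_3)[C_{12},C_{234}]+2C_2[C_{34},C_{123}]=0,$$ $$(-C_{34}-C_3+C_4)[C_{12},C_{23}]+(C_{123}-C_{12}-C_3)[C_{23},C_{34}]+2C_3[C_{12},C_{234}]+(C_{23}-C_2-C_3)[C_{34},C_{123}]=0,$$ $$(-C_{34}+C_3-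C_4)[C_{12},C_{23}]+(-C_{123}-C_{34}+C_3+C_{1234})[C_{23},C_{34}]+(C_{34}-C_4-C_3)[C_{12},C_{234}]+(C_{234}-C_{23}-C_{34}+C_3)[C_{34},C_{123}]=0.$$
   Formalization: The final ''embedding inside 𝔍₂'' fails literally; proved instead is a morphism from ℜ₂ to differential operators with image inside the differential model of 𝔍₂, injective only on the linear span of 1 and the five generators C12, C23, C34, C123, C234. *)

(* Defs.v *)
From HB Require Import structures.
From mathcomp Require Import all_boot all_order all_algebra.
From mathcomp Require Import generic_quotient.
From mathcomp Require Import boolp classical_sets functions reals.
From mathcomp Require Import finmap mpoly.
From mathcomp Require Import ring.
Set Implicit Arguments.
Unset Strict Implicit.
Unset Printing Implicit Defensive.
Import Order.TTheory GRing.Theory Num.Theory.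
Local Open Scope ring_scope.

Section LinearEndomorphisms.
Context {R : comNzRingType} (V : lalgType R).

Definition is_lend : {pred V -> V} := fun f => `[< linear f >].

Lemma is_lend_submod : submod_closed is_lend.
Proof.
split; first by apply/asboolP => a u v; rewrite scaler0 addr0.
move=> k f g /asboolP lf /asboolP lg; apply/asboolP => a u v.
rewrite -[LHS]/(k *: f (a *: u + v) + g (a *: u + v)) lf lg.
rewrite -[RHS]/(a *: (k *: f u + g u) + (k *: f v + g v)).
rewrite !scalerDr !scalerA [k * a]mulrC -!addrA; congr (_ + _).
by rewrite addrCA.
Qed.

HB.instance Definition _ := GRing.isSubmodClosed.Build R (V -> V) is_lend
  is_lend_submod.

Record lend := LEnd { lend_val :> V -> V; _ : lend_val \in is_lend }.

HB.instance Definition _ := [isSub for lend_val].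
HB.instance Definition _ := [Choice of lend by <:].
HB.instance Definition _ := [SubChoice_isSubLmodule of lend by <:].

Lemma lend_linear (f : lend) : linear f.
Proof. by case: f => f /= /asboolP. Qed.

Lemma lendP (f g : lend) : (forall v, f v = g v) -> f = g.
Proof. by move=> fg; apply: val_inj; apply: funext. Qed.

Lemma lendDE (f g : lend) v : (f + g) v = f v + g v.
Proof. by rewrite -[lend_val (f + g)]/(val (f + g)) raddfD. Qed.

Lemma lendZE k (f : lend) v : (k *: f) v = k *: f v.
Proof. by rewrite -[lend_val (k *: f)]/(val (k *: f)) linearZ. Qed.

Lemma linear_is_lend (f : {linear V -> V}) : (f : V -> V) \in is_lend.
Proof. by apply/asboolP => a u v; rewrite linearP. Qed.

Definition lend_of (f : {linear V -> V}) : lend := LEnd (linear_is_lend f).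

Lemma lend_comp_subproof (f g : lend) : f \o g \in is_lend.
Proof. by apply/asboolP => a u v /=; rewrite !lend_linear. Qed.

Definition lend_one : lend := lend_of idfun.
Definition lend_mul (f g : lend) : lend := LEnd (lend_comp_subproof f g).

Lemma lend_mulA : associative lend_mul. Proof. by move=> f g h; apply: lendP. Qed.
Lemma lend_mul1 : left_id lend_one lend_mul. Proof. by move=> f; apply: lendP. Qed.
Lemma lend_mulr1 : right_id lend_one lend_mul. Proof. by move=> f; apply: lendP. Qed.
Lemma lend_mulDl : left_distributive lend_mul +%R.
Proof.
move=> f g h; apply: lendP => v; rewrite lendDE.
by rewrite -[LHS]/((f + g) (h v)) lendDE.
Qed.
Lemma lend_mulDr : right_distributive lend_mul +%R.
Proof.
move=> f g h; apply: lendP => v; rewrite lendDE.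
rewrite -[LHS]/(f ((g + h) v)) lendDE.
by rewrite -[g v]scale1r lend_linear !scale1r.
Qed.
Lemma lend_oner_neq0 : lend_one != 0.
Proof.
apply/eqP => /(congr1 (fun f : lend => f 1)) /=.
by rewrite -[X in _ = X -> _]/(val (0 : lend) 1) raddf0 => /eqP; rewrite oner_eq0.
Qed.

HB.instance Definition _ := GRing.Zmodule_isNzRing.Build lend
  lend_mulA lend_mul1 lend_mulr1 lend_mulDl lend_mulDr lend_oner_neq0.

Lemma lendME (f g : lend) v : (f * g) v = f (g v).
Proof. by []. Qed.

Lemma lend_scaleAl k (f g : lend) : k *: (f * g) = (k *: f) * g.
Proof. by apply: lendP => v; rewrite lendME !lendZE. Qed.

HB.instance Definition _ := GRing.Lmodule_isLalgebra.Build R lend lend_scaleAl.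

Lemma lend_scaleAr k (f g : lend) : k *: (f * g) = f * (k *: g).
Proof.
apply: lendP => v; rewrite lendME !lendZE.
have f0 : f 0 = 0.
  by rewrite -[X in f X](addNr (0 : V)) -scaleN1r lend_linear scaleN1r addNr.
by rewrite -[k *: g v]addr0 lend_linear f0 addr0.
Qed.

HB.instance Definition _ := GRing.Lalgebra_isAlgebra.Build R lend lend_scaleAr.

End LinearEndomorphisms.

(* Differential operators with polynomial coefficients are taken as endomorphisms
   of R[x, y], where x = 'X_0 and y = 'X_1.  In characteristic 0 this action of
   the Weyl algebra is faithful, so no identity is gained or lost. *)
Notation poly2 R := {mpoly R[2]}.

Section DifferentialOperators.
Context (R : realType).
Local Notation D := (lend (poly2 R)).

Lemma mulop_is_linear (p : poly2 R) : linear ( *%R p).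
Proof. by move=> k u v; rewrite mulrDr scalerAr. Qed.

Definition mulop (p : poly2 R) : D := LEnd (asboolT (mulop_is_linear p)).
Definition dx : D := lend_of (mderiv (0 : 'I_2)).
Definition dy : D := lend_of (mderiv (1 : 'I_2)).

Context (a b c : R).
Let x : poly2 R := 'X_0.
Let y : poly2 R := 'X_1.

Definition opX1 : D := mulop x.
Definition opX3 : D := mulop (1 - x - y).
Definition opL1 : D :=
  mulop (y * (1 - x - y)) * dy ^+ 2
  + mulop ((b + 1) *: (1 - x) - (b + c + 2) *: y) * dy.
Definition opL3 : D :=
  mulop (x * y) * (dx ^+ 2 + dy ^+ 2 - 2 * dx * dy)
  + mulop ((a + 1) *: y - (b + 1) *: x) * (dx - dy).
Definition opL : D :=
  mulop (x * (1 - x)) * dx ^+ 2 + mulop (y * (1 - y)) * dy ^+ 2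
  - 2 * mulop (x * y) * dx * dy
  + mulop ((a + 1)%:A - (a + b + c + 3) *: x) * dx
  + mulop ((b + 1)%:A - (a + b + c + 3) *: y) * dy.

End DifferentialOperators.

From mathcomp Require Import monalg.

Lemma malg_scaleAr (R : comNzRingType) (K : monomType) (k : R)
    (u v : {malg R[K]}) : k *: (u * v) = u * (k *: v).
Proof.
apply/malgP => m; rewrite mcoeffZ mcoeffMl.
rewrite (mcoeffMlw _ (fsubset_refl _) (msuppZ_le _ _)) mulr_sumr.
apply: eq_bigr => i _; rewrite mulr_sumr; apply: eq_bigr => j _.
by rewrite [in RHS]mcoeffZ mulrCA mulrnAr.
Qed.

Definition freealg (R : comNzRingType) (I : choiceType) := {malg R[{fmonom I}]}.

Section FreeAlgebra.
Context (R : comNzRingType) (I : choiceType).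
Local Notation F := (freealg R I).

HB.instance Definition _ := GRing.Lalgebra.on F.
HB.instance Definition _ := GRing.Lalgebra_isAlgebra.Build R F
  (@malg_scaleAr R {fmonom I}).

Definition fgen (i : I) : F := mkmalgU (fmu i) 1.

Context (A : algType R) (g : I -> A).

Definition fmonom_eval (m : {fmonom I}) : A := \prod_(i <- (m : seq I)) g i.

Lemma fmonom_eval_mmorphism : mmorphism fmonom_eval.
Proof.
split=> [m1 m2|]; rewrite /fmonom_eval ?fmM ?big_cat //.
by rewrite fm1 big_nil.
Qed.

HB.instance Definition _ :=
  isMultiplicative.Build _ _ fmonom_eval fmonom_eval_mmorphism.

Definition feval : F -> A := mmap (in_alg A) fmonom_eval.

Lemma feval_zmod_morphism : zmod_morphism feval.
Proof. by move=> u v; exact: mmapB. Qed.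

HB.instance Definition _ := GRing.isZmodMorphism.Build F A feval
  feval_zmod_morphism.

Lemma feval_monoid_morphism : monoid_morphism feval.
Proof.
split; first exact: mmap1.
have /commr_mmap_is_multiplicative[fM _] : forall (u : F) m m',
    GRing.comm (in_alg A (mcoeff m u)) (fmonom_eval m').
  by move=> u m m'; rewrite /GRing.comm -scalerAl mul1r -scalerAr mulr1.
exact: fM.
Qed.

HB.instance Definition _ := GRing.isMonoidMorphism.Build F A feval
  feval_monoid_morphism.

Lemma feval_scalable : scalable feval.
Proof. by move=> k u; rewrite /feval mmapZ mulr_algl. Qed.

HB.instance Definition _ := GRing.isScalable.Build R F A *:%R feval
  feval_scalable.

Lemma fevalE i : feval (fgen i) = g i.
Proof.
by rewrite /feval mmapU /fmonom_eval fmU big_seq1 /= scale1r mul1r.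
Qed.

End FreeAlgebra.

(* The two-sided ideal generated by the differences u - v, (u, v) in rels. *)
Inductive ideal_gen (A : nzRingType) (rels : seq (A * A)) : A -> Prop :=
| ideal_gen_rel u v : (u, v) \in rels -> ideal_gen rels (u - v)
| ideal_gen0 : ideal_gen rels 0
| ideal_genD u v : ideal_gen rels u -> ideal_gen rels v -> ideal_gen rels (u + v)
| ideal_genMl w u : ideal_gen rels u -> ideal_gen rels (w * u)
| ideal_genMr w u : ideal_gen rels u -> ideal_gen rels (u * w).

(* [algType] only contains nonzero algebras, hence the properness condition. *)
Record proper_relations (R : comNzRingType) (A : algType R) :=
  ProperRelations {
    relations :> seq (A * A);
    relations_proper : ~ ideal_gen relations 1 }.

Module QuotientAlgebra.
Section QuotientAlgebra.
Context (R : comNzRingType) (F : algType R) (P : proper_relations F).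
Local Notation J := (ideal_gen P).

Definition quotalg_equiv (u v : F) : bool := `[< J (u - v) >].

Lemma idealN u : J u -> J (- u).
Proof. by rewrite -mulN1r; apply: ideal_genMl. Qed.

Lemma idealZ k u : J u -> J (k *: u).
Proof. by rewrite -mulr_algl; apply: ideal_genMl. Qed.

Lemma quotalg_equiv_subproof : equiv_class_of quotalg_equiv.
Proof.
split=> [u|u v|v u w]; first by apply/asboolP; rewrite subrr; exact: ideal_gen0.
  by apply/idP/idP => /asboolP h; apply/asboolP; rewrite -opprB; exact: idealN.
move=> /asboolP uv /asboolP vw; apply/asboolP.
by rewrite -[u](subrK v) -addrA; exact: ideal_genD.
Qed.

Canonical quotalg_equivr := EquivRelPack quotalg_equiv_subproof.

Definition quotalg := {eq_quot quotalg_equiv}%qT.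
#[export] HB.instance Definition _ : EqQuotient F quotalg_equiv quotalg :=
  EqQuotient.on quotalg.
#[export] HB.instance Definition _ := Choice.on quotalg.

Definition qpi (u : F) : quotalg := (\pi_quotalg u)%qT.

Lemma piP u v : qpi u = qpi v <-> J (u - v).
Proof.
split=> [/eqP|h]; last first.
  by apply/eqP; rewrite /qpi eqmodE; apply/asboolP.
by rewrite /qpi eqmodE => /asboolP.
Qed.

Lemma piK (x : quotalg) : qpi (repr x) = x. Proof. exact: reprK. Qed.
Lemma repr_pi u : J (repr (qpi u) - u). Proof. by apply/piP; rewrite piK. Qed.

Definition quotalg_add (x y : quotalg) := qpi (repr x + repr y).
Definition quotalg_opp (x : quotalg) := qpi (- repr x).
Definition quotalg_mul (x y : quotalg) := qpi (repr x * repr y).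
Definition quotalg_scale (k : R) (x : quotalg) := qpi (k *: repr x).

Lemma pi_add u v : quotalg_add (qpi u) (qpi v) = qpi (u + v).
Proof.
by apply/piP; rewrite opprD addrACA; apply: ideal_genD; exact: repr_pi.
Qed.

Lemma pi_opp u : quotalg_opp (qpi u) = qpi (- u).
Proof. by apply/piP; rewrite -opprD; apply: idealN; exact: repr_pi. Qed.

Lemma pi_mul u v : quotalg_mul (qpi u) (qpi v) = qpi (u * v).
Proof.
apply/piP; rewrite -[_ - _](subrKA (u * repr (qpi v))) -mulrBl -mulrBr.
apply: ideal_genD; [apply: ideal_genMr|apply: ideal_genMl]; exact: repr_pi.
Qed.

Lemma pi_scale k u : quotalg_scale k (qpi u) = qpi (k *: u).
Proof. by apply/piP; rewrite -scalerBr; apply: idealZ; exact: repr_pi. Qed.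

Let quotalgE := (pi_add, pi_opp, pi_mul, pi_scale).

Ltac lift_free :=
  repeat match goal with x : quotalg |- _ => rewrite -(piK x); move: (repr x) => {x} ? end;
  rewrite !quotalgE; congr qpi.

Lemma quotalg_addA : associative quotalg_add.
Proof. by move=> x y z; lift_free; rewrite addrA. Qed.
Lemma quotalg_addC : commutative quotalg_add.
Proof. by move=> x y; lift_free; rewrite addrC. Qed.
Lemma quotalg_add0 : left_id (qpi 0) quotalg_add.
Proof. by move=> x; lift_free; rewrite add0r. Qed.
Lemma quotalg_addN : left_inverse (qpi 0) quotalg_opp quotalg_add.
Proof. by move=> x; lift_free; rewrite addNr. Qed.

#[export] HB.instance Definition _ := GRing.isZmodule.Build quotalg
  quotalg_addA quotalg_addC quotalg_add0 quotalg_addN.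

Lemma quotalg_mulA : associative quotalg_mul.
Proof. by move=> x y z; lift_free; rewrite mulrA. Qed.
Lemma quotalg_mul1 : left_id (qpi 1) quotalg_mul.
Proof. by move=> x; lift_free; rewrite mul1r. Qed.
Lemma quotalg_mulr1 : right_id (qpi 1) quotalg_mul.
Proof. by move=> x; lift_free; rewrite mulr1. Qed.
Lemma quotalg_mulDl : left_distributive quotalg_mul quotalg_add.
Proof. by move=> x y z; lift_free; rewrite mulrDl. Qed.
Lemma quotalg_mulDr : right_distributive quotalg_mul quotalg_add.
Proof. by move=> x y z; lift_free; rewrite mulrDr. Qed.
Lemma quotalg_oner_neq0 : qpi 1 != qpi 0.
Proof. by apply/eqP => /piP; rewrite subr0; exact: relations_proper. Qed.

#[export] HB.instance Definition _ := GRing.Zmodule_isNzRing.Build quotalg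
  quotalg_mulA quotalg_mul1 quotalg_mulr1 quotalg_mulDl quotalg_mulDr quotalg_oner_neq0.

Lemma quotalg_scaleA a b x : quotalg_scale a (quotalg_scale b x) = quotalg_scale (a * b) x.
Proof. by lift_free; rewrite scalerA. Qed.
Lemma quotalg_scale1 : left_id 1 quotalg_scale.
Proof. by move=> x; lift_free; rewrite scale1r. Qed.
Lemma quotalg_scaleDr : right_distributive quotalg_scale quotalg_add.
Proof. by move=> k x y; lift_free; rewrite scalerDr. Qed.
Lemma quotalg_scaleDl x a b :
  quotalg_scale (a + b) x = quotalg_add (quotalg_scale a x) (quotalg_scale b x).
Proof. by lift_free; rewrite scalerDl. Qed.

#[export] HB.instance Definition _ := GRing.Zmodule_isLmodule.Build R quotalg
  quotalg_scaleA quotalg_scale1 quotalg_scaleDr quotalg_scaleDl.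

Lemma quotalg_scaleAl k (x y : quotalg) : k *: (x * y) = (k *: x) * y.
Proof.
change (quotalg_scale k (quotalg_mul x y) = quotalg_mul (quotalg_scale k x) y).
by lift_free; rewrite scalerAl.
Qed.

#[export] HB.instance Definition _ := GRing.Lmodule_isLalgebra.Build R quotalg
  quotalg_scaleAl.

Lemma quotalg_scaleAr k (x y : quotalg) : k *: (x * y) = x * (k *: y).
Proof.
change (quotalg_scale k (quotalg_mul x y) = quotalg_mul x (quotalg_scale k y)).
by lift_free; rewrite scalerAr.
Qed.

#[export] HB.instance Definition _ := GRing.Lalgebra_isAlgebra.Build R quotalg
  quotalg_scaleAr.

End QuotientAlgebra.

Module Exports. HB.reexport. End Exports.
End QuotientAlgebra.
Export QuotientAlgebra.Exports.
Export QuotientAlgebra.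

Lemma ideal_gen_eval (R : comNzRingType) (I : choiceType) (A : algType R)
    (g : I -> A) (rels : seq (freealg R I * freealg R I)) u :
  (forall p, p \in rels -> feval g p.1 = feval g p.2) ->
  ideal_gen rels u -> feval g u = 0.
Proof.
move=> h; elim=> [v w /h /= vw||v w _ v0 _ w0|w v _ v0|w v _ v0].
- by apply/eqP; rewrite raddfB subr_eq0; apply/eqP; exact: vw.
- by rewrite raddf0.
- by rewrite raddfD /= v0 w0 addr0.
- by rewrite rmorphM /= v0 mulr0.
- by rewrite rmorphM /= v0 mul0r.
Qed.

Section Commutators.
Context {A : nzRingType}.
Definition com (u v : A) := u * v - v * u.
Definition acom (u v : A) := u * v + v * u.
End Commutators.

Lemma all_relations (A : eqType) (s : seq (A * A)) :
  foldr (fun p P => p.1 = p.2 /\ P) True s -> forall p, p \in s -> p.1 = p.2.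
Proof.
elim: s => [|q s IHs] //= [qE /IHs sP] p.
by rewrite in_cons => /predU1P[->|/sP].
Qed.

Lemma lrmorphE (R : nzRingType) (A B : algType R) (f : {lrmorphism A -> B}) :
   (forall u v, f (com u v) = com (f u) (f v)) *
   (forall u v, f (acom u v) = acom (f u) (f v)) *
   (f 0 = 0) * (f 1 = 1) * (f 2 = 2) * (f (-2) = -2) *
   (forall u v, f (u * v) = f u * f v) *
   (forall u v, f (u + v) = f u + f v) *
   (forall u, f (- u) = - f u) *
   (forall u, f (u ^+ 2) = f u ^+ 2) *
   (forall k u, f (k *: u) = k *: f u).
Proof.
do !split => *.
- by rewrite /com rmorphB !rmorphM.
- by rewrite /acom rmorphD !rmorphM.
- exact: rmorph0.
- exact: rmorph1.
- exact: rmorph_nat.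
- by rewrite rmorphN rmorph_nat.
- exact: rmorphM.
- exact: rmorphD.
- exact: rmorphN.
- exact: rmorphXn.
- exact: linearZ.
Qed.

Variant jacobi2_gen := GL | GL1 | GL3 | GX1 | GX3.
HB.instance Definition _ := gen_eqMixin jacobi2_gen.
HB.instance Definition _ := gen_choiceMixin jacobi2_gen.

Section Jacobi2.
Context (R : realType) (a b c : R).

(* Each pair (u, v) stands for the relation u = v. *)
Definition jacobi2_relations (A : algType R) (g : jacobi2_gen -> A) :
    seq (A * A) :=
  let L := g GL in let L1 := g GL1 in let L3 := g GL3 in
  let X1 := g GX1 in let X3 := g GX3 in
  let s := a + b + c + 1 in
  [:: (com L L1, 0); (com L L3, 0); (com L1 X1, 0); (com L3 X3, 0);
      (com X1 X3, 0);
      (com (com L X1) L,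
       2 * acom X1 L - 2 * L + 2 * L1
       - s *: ((a + b + c + 3) *: X1 - (a + 1)%:A));
      (com (com L X1) L1, 0);
      (com (com L X1) L3,
       acom X1 (L + L3) + acom (X3 - 1) (L - L1)
       - s *: ((a + 1) *: (X1 + X3 - 1) + (b + 1) *: X1));
      (com (com L X1) X1, - 2 * X1 ^+ 2 + 2 * X1);
      (com (com L X1) X3, - 2 * X1 * X3);
      (com (com L X3) L,
       2 * acom X3 L - 2 * L + 2 * L3
       - s *: ((a + b + c + 3) *: X3 - (c + 1)%:A));
      (com (com L X3) L1,
       acom (X1 - 1) (L - L3) + acom X3 (L + L1)
       - s *: ((c + 1) *: (X1 + X3 - 1) + (b + 1) *: X3));
      (com (com L X3) L3, 0);
      (com (com L X3) X1, com (com L X1) X3);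
      (com (com L X3) X3, - 2 * X3 ^+ 2 + 2 * X3);
      (com (com L1 L3) L, 0);
      (com (com L1 L3) L1,
       2 * acom L1 L3 + 2 * L1 ^+ 2 - 2 * L1 * L
       + ((b + c) * (b + 1)) *: (L - L1 - L3)
       - ((b + c) * (c + 1)) *: L3 - ((b - c) * (a + 1)) *: L1);
      (com (com L1 L3) L3,
       - 2 * acom L1 L3 - 2 * L3 ^+ 2 + 2 * L3 * L
       - ((a + b) * (b + 1)) *: (L - L1 - L3)
       + ((a + b) * (a + 1)) *: L1 + ((b - a) * (c + 1)) *: L3);
      (com (com L1 L3) X1,
       - acom (X1 - 1) (L - L1 - L3) - acom X3 (L - L1)
       + (a + 1) *: ((b + 1) *: X3 + (c + 1) *: (X1 + X3 - 1)));
      (com (com L1 L3) X3,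
       acom X1 (L - L3) + acom (X3 - 1) (L - L1 - L3)
       - (c + 1) *: ((a + 1) *: (X1 + X3 - 1) + (b + 1) *: X1));
      (com (com L1 X3) L, com (com L X3) L1);
      (com (com L1 X3) L3, com (com L1 L3) X3);
      (com (com L1 X3) X1, 0);
      (com (com L1 X3) L1,
       2 * acom X3 L1 + acom X1 L1 - 2 * L1
       - (b + c) *: ((b + c + 2) *: X3 - (c + 1) *: (1 - X1)));
      (com (com L1 X3) X3, - 2 * X3 ^+ 2 + 2 * (1 - X1) * X3);
      (com (com L3 X1) L, com (com L X1) L3);
      (com (com L3 X1) L1, - com (com L1 L3) X1);
      (com (com L3 X1) X3, 0);
      (com (com L3 X1) L3,
       acom (2 * X1 + X3 - 1) L3
       - (a + b) *: ((a + 1) *: (X1 + X3 - 1) + (b + 1) *: X1));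
      (com (com L3 X1) X1, - 2 * X1 * (X1 + X3 - 1))].

Definition jacobi2_model (i : jacobi2_gen) : lend (poly2 R) :=
  match i with
  | GL => opL a b c | GL1 => opL1 b c | GL3 => opL3 a b
  | GX1 => opX1 R | GX3 => opX3 R
  end.

(* A one-dimensional representation (evaluation at the vertex x = y = 0), which
   shows that the presented algebra is not zero. *)
Let vertex (i : jacobi2_gen) : R^o :=
  match i with
  | GL => (b + 1) * (b + c) / 2 + (a + 1) * (a + b + c + 1) / 2
  | GL1 => (b + 1) * (b + c) / 2 | GL3 => (a + 1) * (b + 1) / 2
  | GX1 => 0 | GX3 => 1
  end.

Lemma jacobi2_relations_morph (A B : algType R) (f : {lrmorphism A -> B}) g h :
  (forall i, f (g i) = h i) ->
  jacobi2_relations h = [seq (f p.1, f p.2) | p <- jacobi2_relations g].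
Proof.
move=> fg; have fE := lrmorphE f.
move: (GRing.LRMorphism.sort f) fg fE => {}f fg fE.
rewrite /jacobi2_relations /=.
by do ! (congr (_ :: _); first by congr pair; rewrite ?(fE, fg)).
Qed.

Lemma jacobi2_proper : ~ ideal_gen (jacobi2_relations (@fgen R jacobi2_gen)) 1.
Proof.
move=> /(@ideal_gen_eval _ _ _ vertex) h.
suff /h/eqP : forall p, p \in jacobi2_relations (@fgen R jacobi2_gen) ->
    feval vertex p.1 = feval vertex p.2 by rewrite rmorph1 oner_eq0.
have relV : forall p, p \in jacobi2_relations vertex -> p.1 = p.2.
  apply: all_relations; rewrite /jacobi2_relations /=.
  by rewrite /com /acom /GRing.scale /=; do ! split; field.
move=> p pr; apply: (relV (feval vertex p.1, feval vertex p.2)).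
rewrite (@jacobi2_relations_morph _ _ (feval vertex) (@fgen R _)).
  by apply/mapP; exists p.
exact: fevalE.
Qed.

Definition jacobi2 : algType R := quotalg (ProperRelations jacobi2_proper).
Definition jgen (i : jacobi2_gen) : jacobi2 := qpi _ (fgen R i).

End Jacobi2.

Variant racah2_gen :=
  | GC12 | GC23 | GC34 | GC123 | GC234 | GC1 | GC2 | GC3 | GC4 | GC1234.
HB.instance Definition _ := gen_eqMixin racah2_gen.
HB.instance Definition _ := gen_choiceMixin racah2_gen.

Definition racah2_noncentral := [:: GC12; GC23; GC34; GC123; GC234].
Definition racah2_central := [:: GC1; GC2; GC3; GC4; GC1234].

Section Racah2.
Context (R : realType).

Definition racah1_relations (A : algType R) (K M c1 c2 c3 c123 : A) :
    seq (A * A) :=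
  [:: (com K (com K M),
       2 * acom K M + 2 * K ^+ 2 - 2 * (c1 + c2 + c3 + c123) * K
       - 2 * (c1 - c2) * (c3 - c123));
      (com M (com M K),
       2 * acom K M + 2 * M ^+ 2 - 2 * (c1 + c2 + c3 + c123) * M
       - 2 * (c1 - c123) * (c3 - c2))].

Definition racah2_relations (A : algType R) (g : racah2_gen -> A) :
    seq (A * A) :=
  let C12 := g GC12 in let C23 := g GC23 in let C34 := g GC34 in
  let C123 := g GC123 in let C234 := g GC234 in
  let C1 := g GC1 in let C2 := g GC2 in let C3 := g GC3 in
  let C4 := g GC4 in let C1234 := g GC1234 in
  [seq (com (g z) (g w), 0)
     | z <- racah2_central, w <- racah2_noncentral ++ racah2_central] ++
  [:: (com C12 C34, 0); (com C12 C123, 0); (com C23 C123, 0);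
      (com C23 C234, 0); (com C34 C234, 0)] ++
  racah1_relations C12 C23 C1 C2 C3 C123 ++
  racah1_relations C23 C34 C2 C3 C4 C234 ++
  racah1_relations C123 C34 C12 C3 C4 C1234 ++
  racah1_relations C234 C123 C4 C23 C1 C1234 ++
  racah1_relations C234 C12 C2 C34 C1234 C1 ++
  [:: (com C12 C23 + com C23 C34 - com C123 C34 - com C12 C234
       + com C123 C234, 0);
      (2^-1 *: com C34 (com C12 C23),
       C12 * (C23 + C34 - C234 - C3) + C23 * (C34 - C1234) - C34 * C2
       + C123 * (C234 - C34 - C2) - C234 * C3 + (C2 + C3) * C1234 + C2 * C3);
      (2^-1 *: com C23 (com C123 C34),
       C12 * (- C23 + C234 - C4) + C23 * (C123 - C4) + C34 * (C23 - C1)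
       + C123 * (C34 - C234 - C3) - C234 * C3 + (C1 + C3) * C4 + C1 * C3);
      (2^-1 *: com C234 (com C23 C12),
       C12 * (C234 - C4) + C23 * (C12 - C34 + C234 - C1) - C34 * C1
       + C123 * (C34 - C234 - C2) - C234 * C2 + (C1 + C2) * C4 + C1 * C2);
      (2^-1 *: com C234 (com C123 C34),
       C12 * (- C23 + C234 + C4) + C34 * (C23 - C123 - C234 + C1234)
       + C23 * C1234 + C123 * (- C234 + C2) + C234 * C4
       - (C2 + C1234) * C4 - C2 * C1234);
      ((C12 + C234 - C2 - C1234) * com C12 C23
       + (C12 - C2 + C1) * com C23 C34
       + (C123 - C23 - C12 + C2) * com C12 C234
       + (C12 - C2 - C1) * com C34 C123, 0);
      ((- C234 + C34 + C2) * com C12 C23 + (C12 - C1 + C2) * com C23 C34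
       + (C23 - C2 - C3) * com C12 C234 + 2 * C2 * com C34 C123, 0);
      ((- C34 - C3 + C4) * com C12 C23 + (C123 - C12 - C3) * com C23 C34
       + 2 * C3 * com C12 C234 + (C23 - C2 - C3) * com C34 C123, 0);
      ((- C34 + C3 - C4) * com C12 C23
       + (- C123 - C34 + C3 + C1234) * com C23 C34
       + (C34 - C4 - C3) * com C12 C234
       + (C234 - C23 - C34 + C3) * com C34 C123, 0)].

Lemma racah2_relations_morph (A B : algType R) (f : {lrmorphism A -> B}) g h :
  (forall i, f (g i) = h i) ->
  racah2_relations h = [seq (f p.1, f p.2) | p <- racah2_relations g].
Proof.
move=> fg; have fE := lrmorphE f.
move: (GRing.LRMorphism.sort f) fg fE => {}f fg fE.
rewrite /racah2_relations /racah1_relations /=.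
by do ! (congr (_ :: _); first by congr pair; rewrite ?(fE, fg)).
Qed.

Lemma racah2_proper : ~ ideal_gen (racah2_relations (@fgen R racah2_gen)) 1.
Proof.
pose zero (i : racah2_gen) : R^o := 0.
move=> /(@ideal_gen_eval _ _ _ zero) h.
suff /h/eqP : forall p, p \in racah2_relations (@fgen R racah2_gen) ->
    feval zero p.1 = feval zero p.2 by rewrite rmorph1 oner_eq0.
have relV : forall p, p \in racah2_relations zero -> p.1 = p.2.
  apply: all_relations; rewrite /racah2_relations /racah1_relations /=.
  rewrite /com /acom /zero; do ! split;
    by rewrite ?(expr2, oppr0, addr0, mulr0, mul0r, scaler0).
move=> p pr; apply: (relV (feval zero p.1, feval zero p.2)).
rewrite (@racah2_relations_morph _ _ (feval zero) (@fgen R _)).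
  by apply/mapP; exists p.
exact: fevalE.
Qed.

Definition racah2 : algType R := quotalg (ProperRelations racah2_proper).
Definition rgen (i : racah2_gen) : racah2 := qpi _ (fgen R i).

End Racah2.

Definition racah2_of_jacobi2 (R : realType) (a b c d : R) (A : algType R)
    (g : jacobi2_gen -> A) (i : racah2_gen) : A :=
  let L := g GL in let L1 := g GL1 in let L3 := g GL3 in
  let X1 := g GX1 in let X3 := g GX3 in
  let C23 := - L1 + (((b + c + 1) ^+ 2 - 1) / 4)%:A in
  let C34 := - L3 + (((a + b + 1) ^+ 2 - 1) / 4)%:A in
  let C234 := - L + (((a + b + c + 2) ^+ 2 - 1) / 4)%:A in
  let m := ((a + d + 2) ^+ 2 - (d - b - c) ^+ 2) / 4 in
  match i with
  | GC23 => C23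
  | GC34 => C34
  | GC234 => C234
  | GC123 =>
      ((a + d + 2) / 2) *: com X1 C234 - 2^-1 *: acom X1 C234 - m *: X1
      + ((a ^+ 2 + (a + d + 2) ^+ 2 - 2) / 4)%:A
  | GC12 =>
      - (((a + d + 2) / 2) *: com X3 C234) + 2^-1 *: acom (X3 - 1) C234
      + m *: (X3 - 1) + C34 + (((a + d + 2) ^+ 2 - 1) / 4)%:A
  | GC1 => (((d - b - c) ^+ 2 - 1) / 4)%:A
  | GC2 => ((c ^+ 2 - 1) / 4)%:A
  | GC3 => ((b ^+ 2 - 1) / 4)%:A
  | GC4 => ((a ^+ 2 - 1) / 4)%:A
  | GC1234 => (((a + d + 2) ^+ 2 - 1) / 4)%:A
  end.

(* Main.v *)
(* All relations are identities between differential operators, so they live in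
   the Weyl algebra in x, y with coefficients polynomial in the parameters and
   a power of 2 as denominator.  That algebra is an iterated Ore extension of Z
   by the parameters, x, y, dx, dy; a computable normal form of its elements,
   with a correctness proof for evaluation in any algebra containing a Weyl
   family, decides each relation.  The universal properties of the presented
   algebras then give the two representations, and the image of the Racah
   algebra lies in that of the Jacobi algebra because its generators do.  Linear
   independence is read off the principal symbols: [[T, x], x] and [[T, y], y]
   are multiplications by twice the coefficients of dx^2 and dy^2 in T. *)

Require Import Defs.
From HB Require Import structures.
From Stdlib Require Import BinInt.
From mathcomp Require Import all_boot all_order all_algebra.
From mathcomp Require Import boolp reals mpoly monalg.
From mathcomp Require Import ssrZ ring lra.
Import GRing.Theory Num.Theory.
Local Open Scope ring_scope.

Set Implicit Arguments.
Unset Strict Implicit.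
Unset Printing Implicit Defensive.

(* Dense iterated polynomials: [s : opoly n.+1] stands for the sum of the
   [s_i * v_n ^+ i], with coefficients written to the left of the variable. *)
Fixpoint opoly (n : nat) : Type := if n is m.+1 then seq (opoly m) else Z.

(** * Arithmetic of normal forms in an iterated Ore extension of the integers *)

Section OrePolynomials.
(* For [i < j], [v_j v_i - v_i v_j] is 1 if [i = dual j] and 0 otherwise; a
   variable without a conjugate is marked by [dual j = j]. *)
Variable dual : nat -> nat.

Definition opoly0 n : opoly n := if n is m.+1 then [::] else (Z0 : Z).

Definition opoly_nil n : opoly n -> bool :=
  if n is m.+1 then fun s : seq (opoly m) => if s is [::] then true else false
  else fun z : Z => Z.eqb z Z0.

(** Dropping a trailing zero keeps the lists short during computation; evaluation does not see
    it. *)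
Definition ocons n (p : opoly n) (s : seq (opoly n)) : opoly n.+1 :=
  if s is [::] then if opoly_nil p then [::] else [:: p] else p :: s.

Definition omap n (f : opoly n -> opoly n) : opoly n.+1 -> opoly n.+1 :=
  foldr (fun p => ocons (f p)) [::].

Fixpoint oadd n : opoly n -> opoly n -> opoly n :=
  if n is m.+1 then
    fix add (s t : opoly m.+1) {struct s} : opoly m.+1 :=
      match s, t with
      | p :: s', q :: t' => ocons (oadd p q) (add s' t')
      | [::], _ => t
      | _, [::] => s
      end
  else Z.add.

Fixpoint oscale (k : Z) n : opoly n -> opoly n :=
  if n is m.+1 then omap (@oscale k m) else Z.mul k.

(** Formal partial derivative in [v_i], by the Leibniz rule on the Horner form [p + s' * v_m]. *)
Fixpoint oderiv (i n : nat) : opoly n -> opoly n :=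
  if n is m.+1 return opoly n -> opoly n then
    fix deriv (s : opoly m.+1) : opoly m.+1 :=
      if s is p :: s' then
        oadd (n := m.+1) (if m == i then s' else [::])
          (ocons (oderiv i p) (deriv s'))
      else [::]
  else fun _ : Z => Z0.

(** Normal form of [v_n * s], that is, of [s * v_n] plus the commutator of [v_n] with [s]. Since
    [v_n] commutes with its own powers, the commutator acts on the coefficients only, as the
    derivative in the conjugate variable. *)
Definition oshift n (s : opoly n.+1) : opoly n.+1 :=
  oadd (ocons (opoly0 n) s) (omap (oderiv (dual n) (n:=n)) s).

(** The Horner step [(p + s' * v_n) * t = p * t + s' * (v_n * t)]: passing [v_n] on to [t] keeps the
    recursion structural in the left factor. *)
Fixpoint omul n : opoly n -> opoly n -> opoly n :=
  if n is m.+1 then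
    fix mul (s t : opoly m.+1) {struct s} : opoly m.+1 :=
      if s is p :: s' then
        oadd (n := m.+1) (if opoly_nil p then [::] else omap (omul p) t)
          (mul s' (oshift t))
      else [::]
  else Z.mul.

Fixpoint oconst (k : Z) (n : nat) : opoly n :=
  if n is m.+1 then ocons (oconst k m) [::] else k.

Fixpoint ovar (i n : nat) : opoly n :=
  if n is m.+1 return opoly n then
    if m == i then [:: opoly0 m; oconst Z.one m] else ocons (ovar i m) [::]
  else (Z0 : Z).

Fixpoint oeq0 n : opoly n -> bool :=
  if n is m.+1 then all (@oeq0 m) else fun z : Z => Z.eqb z Z0.

Context (R : comNzRingType) (A : algType R) (v : nat -> A).

Fixpoint oeval n : opoly n -> A :=
  if n is m.+1 then foldr (fun p u => oeval p + u * v m) 0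
  else fun z : Z => (int_of_Z z)%:~R.

Lemma oeval0 n : oeval (opoly0 n) = 0. Proof. by case: n. Qed.

Lemma oeval_nil n (p : opoly n) : opoly_nil p -> oeval p = 0.
Proof. by case: n p => [z /Z.eqb_eq ->|n []]. Qed.

Lemma oeval_consE n p s :
  @oeval n.+1 (p :: s) = oeval p + @oeval n.+1 s * v n.
Proof. by []. Qed.

Lemma oeval_cons n (p : opoly n) (s : opoly n.+1) :
  oeval (ocons p s) = oeval p + oeval s * v n.
Proof.
case: s => [|q s] //; rewrite /ocons; case: ifP => //= /oeval_nil ->.
by rewrite mul0r addr0.
Qed.

Lemma oevalD n (p q : opoly n) : oeval (oadd p q) = oeval p + oeval q.
Proof.
elim: n p q => [p q|n IHn]; first by rewrite /= -intrD -raddfD.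
elim=> [|p s IHs] [|q t]; rewrite ?(add0r, addr0) //.
rewrite -/(oadd _ _) -[oadd _ _]/(ocons (oadd p q) (@oadd n.+1 s t)).
by rewrite oeval_cons IHn IHs /= mulrDl addrACA.
Qed.

Lemma oevalZ k n (p : opoly n) :
  oeval (oscale k p) = (int_of_Z k)%:~R * oeval p.
Proof.
elim: n p => [p|n IHn]; first by rewrite /= -intrM -rmorphM.
elim=> [|p s IHs]; first by rewrite [RHS]mulr0.
by rewrite [LHS]oeval_cons IHs IHn mulrDr mulrA.
Qed.

Lemma oeval_const k n : oeval (oconst k n) = (int_of_Z k)%:~R.
Proof. by elim: n => // n IHn; rewrite [LHS]oeval_cons IHn mul0r addr0. Qed.

Lemma oeval_var i n : (i < n)%N -> oeval (ovar i n) = v i.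
Proof.
elim: n => // n IHn; rewrite ltnS leq_eqVlt eq_sym.
rewrite -[ovar i n.+1]/(if n == i then [:: opoly0 n; oconst Z.one n]
                        else ocons (ovar i n) [::]).
case: eqP => [<- _|_ /IHn IH].
  by rewrite /= oeval0 oeval_const mul0r addr0 add0r -[RHS]mul1r.
by rewrite oeval_cons IH /= mul0r addr0.
Qed.

Lemma oeval_eq0 n (p : opoly n) : oeq0 p -> oeval p = 0.
Proof.
elim: n p => [p /Z.eqb_eq -> //|n IHn].
by elim=> //= p s IHs /andP[/IHn -> /IHs ->]; rewrite mul0r addr0.
Qed.

Hypothesis vM : forall i j, (i < j)%N ->
  v j * v i = v i * v j + (i == dual j)%:R.

(** Commutation with [v_j] is a derivation; by [vM] it sends [v_i], for [i < j], to 1 if [i] is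
    conjugate to [j] and to 0 otherwise, so on polynomials in the earlier variables it is a partial
    derivative. *)
Lemma oeval_deriv n j (p : opoly n) : (n <= j)%N ->
  v j * oeval p = oeval p * v j + oeval (oderiv (dual j) p).
Proof.
elim: n p => [p _|n IHn p lt_nj].
  by rewrite addr0 [RHS]mulrzl [LHS]mulrzr.
elim: p => [|p s IHs]; first by rewrite [LHS]mulr0 mul0r add0r.
rewrite -[oderiv _ _]/(oadd (n := n.+1) (if n == dual j then s else [::])
  (ocons (oderiv (dual j) p) (@oderiv (dual j) n.+1 s))).
rewrite oevalD; have -> : @oeval n.+1 (if n == dual j then s else [::]) =
    @oeval n.+1 s * (n == dual j)%:R.
  by case: eqP; rewrite (mulr0, mulr1).
rewrite oeval_cons oeval_consE mulrDr IHn ?(ltnW lt_nj) // mulrA IHs.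
rewrite !mulrDl -[_ * v j * v n]mulrA vM // mulrDr !mulrA -!addrA.
by congr (_ + _); rewrite addrCA; congr (_ + _); apply: addrCA.
Qed.

Lemma oeval_shift n (s : opoly n.+1) : oeval (oshift s) = v n * oeval s.
Proof.
rewrite oevalD oeval_cons oeval0 add0r.
elim: s => [|p s IHs]; first by rewrite /= mul0r mulr0 addr0.
rewrite -[omap _ _]/(ocons (oderiv (dual n) p)
  (omap (oderiv (dual n) (n := n)) s)).
rewrite oeval_cons oeval_consE mulrDr oeval_deriv // mulrA -IHs !mulrDl -!addrA.
by congr (_ + _); rewrite addrCA.
Qed.

Lemma oevalM n (p q : opoly n) : oeval (omul p q) = oeval p * oeval q.
Proof.
elim: n p q => [p q|n IHn]; first by rewrite /= -intrM -rmorphM.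
elim=> [|p s IHs] t; first by rewrite [RHS]mul0r.
rewrite -[omul _ _]/(oadd (n := n.+1)
  (if opoly_nil p then [::] else omap (omul p) t) (@omul n.+1 s (oshift t))).
rewrite oevalD IHs oeval_shift oeval_consE mulrDl mulrA; congr (_ + _).
case: ifP => [/oeval_nil->|_]; first by rewrite mul0r.
elim: t => [|q t IHt]; first by rewrite [RHS]mulr0.
rewrite -[omap _ _]/(ocons (omul p q) (omap (omul p) t)).
by rewrite oeval_cons IHn IHt oeval_consE mulrDr mulrA.
Qed.

End OrePolynomials.

(* The pair [(k, p)] stands for [p / 2 ^ k]. *)
Definition dyad n := (nat * opoly n)%type.

(** * Normal forms with powers of 2 as denominators *)

Section DyadicRepresentation.
Variables (dual : nat -> nat) (n : nat).

Definition dlift k (s : dyad n) : opoly n :=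
  iter (k - s.1) (oscale (Z.of_nat 2) (n := n)) s.2.
Definition dadd (s t : dyad n) : dyad n :=
  let k := maxn s.1 t.1 in (k, oadd (dlift k s) (dlift k t)).
Definition dmul (s t : dyad n) : dyad n := ((s.1 + t.1)%N, omul dual s.2 t.2).
Definition dint k : dyad n := (0%N, oconst k n).
Definition dopp (s : dyad n) : dyad n := (s.1, oscale (Zneg xH) s.2).
Definition dhalf (s : dyad n) : dyad n := (s.1.+1, s.2).
Definition dvar i : dyad n := (0%N, ovar i n).
Definition dsqr s := dmul s s.
Definition dcom s t := dadd (dmul s t) (dopp (dmul t s)).
Definition dacom s t := dadd (dmul s t) (dmul t s).
Definition deq s t := oeq0 (dadd s (dopp t)).2.

Record ore_family (R : comNzRingType) (A : algType R) := OreFamily {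
  ore_var :> nat -> A;
  ore_varM : forall i j, (i < j)%N ->
    ore_var j * ore_var i = ore_var i * ore_var j + (i == dual j)%:R }.

Context (R : numFieldType) (A : algType R) (v : ore_family A).
Implicit Types (u w : A) (s t : dyad n) (k l : R).

(** The denominator is cleared on the side of [u], so that only integer polynomials are
    evaluated. *)
Definition rep u s := 2 ^+ s.1 *: u = oeval v s.2.

Lemma rep_lift m u s : rep u s -> (s.1 <= m)%N ->
  oeval v (dlift m s) = 2 ^+ m *: u.
Proof.
move=> us le_sm; rewrite -(subnK le_sm) exprD -scalerA us /dlift subnK //.
elim: (m - s.1)%N => [|j IHj]; first by rewrite scale1r.
by rewrite iterS oevalZ exprS -scalerA -IHj scaler_nat [LHS]mulr_natl.
Qed.

Lemma repD u w s t : rep u s -> rep w t -> rep (u + w) (dadd s t).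
Proof.
move=> us wt; rewrite /rep /dadd /= oevalD.
by rewrite (rep_lift us) ?(rep_lift wt) ?leq_maxl ?leq_maxr // scalerDr.
Qed.

Lemma repN u s : rep u s -> rep (- u) (dopp s).
Proof. by move=> us; rewrite /rep /dopp /= oevalZ -us scalerN mulN1r. Qed.

Lemma repM u w s t : rep u s -> rep w t -> rep (u * w) (dmul s t).
Proof.
move=> us wt; rewrite /rep /dmul /= (oevalM (@ore_varM _ _ v)) -us -wt.
by rewrite -scalerAl -scalerAr scalerA exprD.
Qed.

Lemma repX2 u s : rep u s -> rep (u ^+ 2) (dsqr s).
Proof. by move=> us; apply: repM. Qed.

Lemma rep_com u w s t : rep u s -> rep w t -> rep (com u w) (dcom s t).
Proof. by move=> us wt; apply: repD; [|apply: repN]; apply: repM. Qed.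

Lemma rep_acom u w s t : rep u s -> rep w t -> rep (acom u w) (dacom s t).
Proof. by move=> us wt; apply: repD; apply: repM. Qed.

Lemma rep_nat m : rep m%:R (dint (Z.of_nat m)).
Proof.
by rewrite /rep scale1r oeval_const -[Z.of_nat m]/(Z_of_int m) Z_of_intK.
Qed.

Lemma rep0 : rep 0 (dint Z0). Proof. exact: (rep_nat 0). Qed.
Lemma rep1 : rep 1 (dint (Zpos xH)). Proof. exact: (rep_nat 1). Qed.

Lemma rep_var i : (i < n)%N -> rep (v i) (dvar i).
Proof. by move=> lt_in; rewrite /rep scale1r oeval_var. Qed.

Lemma repZ k u s t : rep k%:A s -> rep u t -> rep (k *: u) (dmul s t).
Proof. by rewrite -[k *: u]mulr_algl; apply: repM. Qed.

Lemma rep_half k s : rep k%:A s -> rep (k / 2)%:A (dhalf s).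
Proof.
rewrite /rep /= => <-; rewrite !scalerA exprSr.
by congr (_ *: _); rewrite mulrACA mulrV ?mulr1 ?unitfE ?pnatr_eq0.
Qed.

Lemma rep_inv2 : rep (2^-1)%:A (dhalf (dint (Zpos xH))).
Proof.
by rewrite -[2^-1]mul1r; apply: rep_half; rewrite scale1r; apply: rep1.
Qed.

Lemma rep_algD k l s t : rep k%:A s -> rep l%:A t -> rep (k + l)%:A (dadd s t).
Proof. by rewrite scalerDl; apply: repD. Qed.

Lemma rep_algN k s : rep k%:A s -> rep (- k)%:A (dopp s).
Proof. by rewrite scaleNr; apply: repN. Qed.

Lemma rep_algM k l s t : rep k%:A s -> rep l%:A t -> rep (k * l)%:A (dmul s t).
Proof. by rewrite -scalerA; apply: repZ. Qed.

Lemma rep_algX2 k s : rep k%:A s -> rep (k ^+ 2)%:A (dsqr s).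
Proof. by move=> ks; apply: rep_algM. Qed.

Lemma rep_alg_nat m : rep (m%:R)%:A (dint (Z.of_nat m)).
Proof. by rewrite scaler_nat; apply: rep_nat. Qed.

Lemma rep_alg1 : rep 1%:A (dint (Zpos xH)).
Proof. by rewrite scale1r; apply: rep1. Qed.

Lemma rep_quarter k s : rep k%:A s -> rep (k / 4)%:A (dhalf (dhalf s)).
Proof.
move=> ks; have -> : k / 4 = k / 2 / 2 by field.
by do 2!apply: rep_half.
Qed.

(** Soundness of the decision procedure: a zero normal form for [u - w] means that a power of 2
    times [u - w] vanishes, and that power is a nonzero scalar. *)
Lemma rep_eq u w s t : rep u s -> rep w t -> deq s t -> u = w.
Proof.
move=> us wt /(oeval_eq0 v); rewrite -(repD us (repN wt)) => /eqP.
by rewrite scaler_eq0 expf_eq0 pnatr_eq0 andbF subr_eq0 => /eqP.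
Qed.

End DyadicRepresentation.

(* The Weyl algebra in two variables with four central parameters *)
Declare Scope dyad_scope.
Delimit Scope dyad_scope with dyad.
Local Notation W := (dyad 8).
(** Variables 0 to 3 are the parameters, 4 and 5 are x and y, 6 and 7 the corresponding
    derivatives. *)
Definition weyl_dual j := match j with 6 => 4 | 7 => 5 | _ => j end.
Local Notation weyl_family := (ore_family weyl_dual).
Local Infix "+" := (@dadd 8) : dyad_scope.
Local Infix "*" := (@dmul weyl_dual 8) : dyad_scope.
Local Notation "- s" := (@dopp 8 s) : dyad_scope.
Local Notation "s - t" := (@dadd 8 s (@dopp 8 t)) : dyad_scope.
Local Notation "s ^2" := (@dsqr weyl_dual 8 s)
  (at level 1, format "s ^2") : dyad_scope.
Local Notation "n %:W" := (dint 8 (Z.of_nat n))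
  (at level 2, format "n %:W") : dyad_scope.
Local Notation wcom := (@dcom weyl_dual 8).
Local Notation wacom := (@dacom weyl_dual 8).
Local Notation wvar := (@dvar 8).

Section WeylNormalForms.
Local Open Scope dyad_scope.

(* The fourth variable is e = a + d + 2 rather than d: the C's have degree 1 in
   it, since e^2 - (d - b - c)^2 = (a + b + c + 2) (2 e - (a + b + c + 2)). *)
Let a := wvar 0. Let b := wvar 1. Let c := wvar 2. Let e := wvar 3.
Let d := e - a - 2%:W.
Let x := wvar 4. Let y := wvar 5. Let dx := wvar 6. Let dy := wvar 7.

Definition jacobi2_nf (i : jacobi2_gen) : W :=
  match i with
  | GX1 => x
  | GX3 => 1%:W - x - y
  | GL1 => y * (1%:W - x - y) * dy^2
           + ((b + 1%:W) * (1%:W - x) - (b + c + 2%:W) * y) * dy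
  | GL3 => x * y * (dx^2 + dy^2 - 2%:W * dx * dy)
           + ((a + 1%:W) * y - (b + 1%:W) * x) * (dx - dy)
  | GL => x * (1%:W - x) * dx^2 + y * (1%:W - y) * dy^2
          - 2%:W * (x * y) * dx * dy
          + (a + 1%:W - (a + b + c + 3%:W) * x) * dx
          + (b + 1%:W - (a + b + c + 3%:W) * y) * dy
  end.

Definition racah2_nf (i : racah2_gen) : W :=
  let X1 := jacobi2_nf GX1 in let X3 := jacobi2_nf GX3 in
  let quarter s := dhalf (dhalf s) in
  let C34 := - jacobi2_nf GL3 + quarter ((a + b + 1%:W)^2 - 1%:W) in
  let C234 := - jacobi2_nf GL + quarter ((a + b + c + 2%:W)^2 - 1%:W) in
  let m := quarter (e^2 - (d - b - c)^2) in
  match i with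
  | GC23 => - jacobi2_nf GL1 + quarter ((b + c + 1%:W)^2 - 1%:W)
  | GC34 => C34
  | GC234 => C234
  | GC123 => dhalf e * wcom X1 C234 - dhalf 1%:W * wacom X1 C234 - m * X1
             + quarter (a^2 + e^2 - 2%:W)
  | GC12 => - (dhalf e * wcom X3 C234) + dhalf 1%:W * wacom (X3 - 1%:W) C234
            + m * (X3 - 1%:W) + C34 + quarter (e^2 - 1%:W)
  | GC1 => quarter ((d - b - c)^2 - 1%:W)
  | GC2 => quarter (c^2 - 1%:W)
  | GC3 => quarter (b^2 - 1%:W)
  | GC4 => quarter (a^2 - 1%:W)
  | GC1234 => quarter (e^2 - 1%:W)
  end.

End WeylNormalForms.

(** Quotients by 2 and 4 are matched before products, since division is a product with an inverse.
    Hypotheses come first, so that a + d + 2 is read as the single variable e. *)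
Ltac rep_scalar :=
  lazymatch goal with
  | H : rep _ ?u _ |- rep _ ?u _ => exact: H
  | |- rep _ ((_ / 4) *: 1) _ => apply: rep_quarter; rep_scalar
  | |- rep _ ((_ / 2) *: 1) _ => apply: rep_half; rep_scalar
  | |- rep _ ((2^-1) *: 1) _ => exact: rep_inv2
  | |- rep _ ((_ + _) *: 1) _ => apply: rep_algD; rep_scalar
  | |- rep _ ((_ * _) *: 1) _ => apply: rep_algM; rep_scalar
  | |- rep _ ((_ ^+ 2) *: 1) _ => apply: rep_algX2; rep_scalar
  | |- rep _ ((- _) *: 1) _ => apply: rep_algN; rep_scalar
  | |- rep _ (1 *: 1) _ => exact: rep_alg1
  | |- rep _ (_%:R *: 1) _ => exact: rep_alg_nat
  end.

Ltac rep_op :=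
  lazymatch goal with
  | H : rep _ ?u _ |- rep _ ?u _ => exact: H
  | H : forall i, rep _ (?g i) _ |- rep _ (?g _) _ => exact: H
  | |- rep _ (com _ _) _ => apply: rep_com; rep_op
  | |- rep _ (acom _ _) _ => apply: rep_acom; rep_op
  | |- rep _ (_ + _) _ => apply: repD; rep_op
  | |- rep _ (- _) _ => apply: repN; rep_op
  | |- rep _ (_ * _) _ => apply: repM; rep_op
  | |- rep _ (_ ^+ 2) _ => apply: repX2; rep_op
  | |- rep _ (_ *: 1) _ => rep_scalar
  | |- rep _ (_ *: _) _ => apply: repZ; [rep_scalar | rep_op]
  | |- rep _ 1 _ => exact: rep1
  | |- rep _ 0 _ => exact: rep0
  | |- rep _ _%:R _ => exact: rep_nat
  end.

(** [rep_eq] leaves both normal forms as existential variables; [rep_op] fills them in along the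
    syntax of the two sides, and [deq] becomes a closed boolean. *)
Ltac weyl := apply: rep_eq; [rep_op | rep_op | by vm_compute].

(** * The relations in any algebra with a Weyl family *)

Section WeylRelations.
Context (R : realType) (A : algType R) (v : weyl_family A) (a b c d : R).
Hypotheses (v0 : v 0 = a%:A) (v1 : v 1 = b%:A) (v2 : v 2 = c%:A).
Hypothesis v3 : v 3 = (a + d + 2)%:A.

Let rep_a : rep v a%:A (wvar 0). Proof. by rewrite -v0; apply: rep_var. Qed.
Let rep_b : rep v b%:A (wvar 1). Proof. by rewrite -v1; apply: rep_var. Qed.
Let rep_c : rep v c%:A (wvar 2). Proof. by rewrite -v2; apply: rep_var. Qed.
Let rep_e : rep v (a + d + 2)%:A (wvar 3).
Proof. by rewrite -v3; apply: rep_var. Qed.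
(** [d] is not a variable of the family; it is recovered from e = a + d + 2. *)
Let rep_d : rep v d%:A (wvar 3 - wvar 0 - 2%:W)%dyad.
Proof.
have -> : d = a + d + 2 - a - 2 by ring.
rep_scalar.
Qed.

Lemma jacobi2_relations_rep (g : jacobi2_gen -> A) :
  (forall i, rep v (g i) (jacobi2_nf i)) ->
  forall p, p \in jacobi2_relations a b c g -> p.1 = p.2.
Proof.
move=> rep_g; apply: all_relations; rewrite /jacobi2_relations /=.
do !split; weyl.
Qed.

(** The parameters are indeterminates of the normal forms, so a single computation per relation
    covers all their real values. *)
Lemma racah2_relations_rep (g : racah2_gen -> A) :
  (forall i, rep v (g i) (racah2_nf i)) ->
  forall p, p \in racah2_relations g -> p.1 = p.2.
Proof.
move=> rep_g; apply: all_relations.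
rewrite /racah2_relations /racah1_relations /=.
do !split; weyl.
Qed.

Lemma racah2_of_jacobi2_rep (g : jacobi2_gen -> A) :
  (forall i, rep v (g i) (jacobi2_nf i)) ->
  forall i, rep v (racah2_of_jacobi2 a b c d g i) (racah2_nf i).
Proof. by move=> rep_g [] /=; rep_op. Qed.

End WeylRelations.

(** * The Weyl family acting on polynomials in x and y *)

Section PolynomialModel.
Context (R : realType).
Local Notation D := (lend (poly2 R)).

Lemma lend0E u : (0 : D) u = 0.
Proof. by rewrite -(scale0r (0 : D)) lendZE scale0r. Qed.

Lemma mulopD (p q : poly2 R) : mulop (p + q) = mulop p + mulop q.
Proof. by apply: lendP => u; rewrite lendDE /= mulrDl. Qed.

Lemma mulop0 : mulop (0 : poly2 R) = 0.
Proof. by apply: lendP => u; rewrite lend0E /= mul0r. Qed.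

Lemma mulopZ k (p : poly2 R) : mulop (k *: p) = k *: mulop p.
Proof. by apply: lendP => u; rewrite lendZE /= scalerAl. Qed.

Lemma mulopN (p : poly2 R) : mulop (- p) = - mulop p.
Proof. by rewrite -scaleN1r mulopZ scaleN1r. Qed.

Lemma mulopM (p q : poly2 R) : mulop (p * q) = mulop p * mulop q.
Proof. by apply: lendP => u /=; rewrite mulrA. Qed.

Lemma mulop1 : mulop (1 : poly2 R) = 1.
Proof. by apply: lendP => u /=; rewrite mul1r. Qed.

Definition mulopE := (mulopD, mulopN, mulopZ, mulopM, mulop1).

Lemma dx_mulopX (i j : 'I_2) :
  lend_of (mderiv i) * mulop 'X_j
  = mulop 'X_j * lend_of (mderiv i) + (j == i)%:R :> D.
Proof.
apply: lendP => u; rewrite lendDE /= mderivM mderivX mnm1E addrC.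
congr (_ + _); case: eqP => [->|_].
  have -> : (U_(i) - U_(i))%MM = 0%MM by apply/mnmP => k; rewrite !mnmE subnn.
  by rewrite scale1r mpolyX0 mul1r.
by rewrite scale0r mul0r mulr0n lend0E.
Qed.

Lemma mulopC (p q : poly2 R) : mulop p * mulop q = mulop q * mulop p.
Proof. by rewrite -!mulopM mulrC. Qed.

Lemma mderivC (i j : 'I_2) :
  GRing.comm (lend_of (mderiv i) : D) (lend_of (mderiv j)).
Proof. by apply: lendP => u; exact: mderiv_comm. Qed.

Section Family.
Variables a b c d : R.

Definition weyl_gen : nat -> D :=
  nth 0 [:: a%:A; b%:A; c%:A; (a + d + 2)%:A;
            mulop 'X_0; mulop 'X_1; dx R; dy R].

Lemma weyl_genM i j : (i < j)%N ->
  weyl_gen j * weyl_gen i = weyl_gen i * weyl_gen j + (i == weyl_dual j)%:R.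
Proof.
move=> lt_ij; have [le_8j|lt_j8] := leqP 8 j.
  (* From index 8 on the generator is the default 0 and [weyl_dual j = j] differs from [i], so both
     sides vanish. *)
  rewrite /weyl_gen [nth _ _ j]nth_default // mul0r mulr0 add0r.
  by case: j le_8j lt_ij => [|[|[|[|[|[|[|[|j]]]]]]]] // _ /ltn_eqF ->.
have algC k (u : D) : u * k%:A = k%:A * u by rewrite mulr_algl mulr_algr.
case: i j lt_j8 lt_ij =>
    [|[|[|[|[|[|[|[|i]]]]]]]] [|[|[|[|[|[|[|[|j]]]]]]]] //=;
  rewrite /weyl_gen /= ?addr0 => _ _; try exact: algC; try exact: mulopC;
  by rewrite ?dx_mulopX ?addr0 //; apply: mderivC.
Qed.

Definition poly2_family := OreFamily weyl_genM.

Lemma jacobi2_model_rep i :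
  rep poly2_family (jacobi2_model a b c i) (jacobi2_nf i).
Proof.
(* Each [weyl_gen j] is restated as a concrete operator, because [rep_op] selects hypotheses by the
   shape of the operator. *)
pose rep_gen j : (j < 8)%N -> rep poly2_family (weyl_gen j) (wvar j) :=
  @rep_var _ _ _ _ _ j.
have rep_a : rep poly2_family a%:A _ := rep_gen 0 isT.
have rep_b : rep poly2_family b%:A _ := rep_gen 1 isT.
have rep_c : rep poly2_family c%:A _ := rep_gen 2 isT.
have rep_x : rep poly2_family (mulop 'X_0) _ := rep_gen 4 isT.
have rep_y : rep poly2_family (mulop 'X_1) _ := rep_gen 5 isT.
have rep_dx : rep poly2_family (dx R) _ := rep_gen 6 isT.
have rep_dy : rep poly2_family (dy R) _ := rep_gen 7 isT.
by case: i;
  rewrite /jacobi2_model /opL /opL1 /opL3 /opX1 /opX3 ?mulopE /jacobi2_nf;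
  rep_op.
Qed.

Lemma racah2_model_rep i :
  rep poly2_family (racah2_of_jacobi2 a b c d (jacobi2_model a b c) i)
    (racah2_nf i).
Proof.
by apply: racah2_of_jacobi2_rep; rewrite // => j; apply: jacobi2_model_rep.
Qed.

End Family.

Lemma jacobi2_model_relations (a b c : R) p :
  p \in jacobi2_relations a b c (jacobi2_model a b c) -> p.1 = p.2.
Proof.
(* The Jacobi relations do not involve [d]; the value 0 is an arbitrary choice. *)
apply: (@jacobi2_relations_rep _ _ (poly2_family a b c 0)) => // i.
exact: jacobi2_model_rep.
Qed.

Lemma racah2_model_relations (a b c d : R) p :
  p \in racah2_relations (racah2_of_jacobi2 a b c d (jacobi2_model a b c)) ->
  p.1 = p.2.
Proof. by apply: racah2_relations_rep => i; apply: racah2_model_rep. Qed.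

End PolynomialModel.

(** * Universal properties of the presented algebras *)

Section FreeAlgebraEvaluation.
Context (R : comNzRingType) (I : choiceType).

Lemma feval_comp (A B : algType R) (f : {lrmorphism A -> B}) (g : I -> A) u :
  feval (fun i => f (g i)) u = f (feval g u).
Proof.
rewrite /feval !mmapE raddf_sum; apply: eq_bigr => m _ /=.
rewrite rmorphM /= rmorph_alg; congr (_ * _).
by rewrite /fmonom_eval rmorph_prod.
Qed.

Section QuotientEvaluation.
Context (A : algType R) (g : I -> A) (P : proper_relations (freealg R I)).
Hypothesis gP : forall p, p \in (P : seq _) -> feval g p.1 = feval g p.2.

Definition quotalg_eval (u : quotalg P) : A := feval g (repr u).

(** The chosen representative of the class of [u] differs from [u] by an element of the ideal, which
    [feval g] kills. *)
Lemma quotalg_eval_pi u : quotalg_eval (qpi P u) = feval g u.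
Proof.
apply/eqP; rewrite -subr_eq0 -raddfB; apply/eqP/(ideal_gen_eval gP).
exact: repr_pi.
Qed.

Lemma quotalg_eval_zmod_morphism : zmod_morphism quotalg_eval.
Proof.
move=> u w; rewrite -(piK u) -(piK w).
rewrite -[qpi P _ - _]/(quotalg_add _ (quotalg_opp _)).
rewrite QuotientAlgebra.pi_opp QuotientAlgebra.pi_add.
by rewrite !quotalg_eval_pi raddfB.
Qed.

Lemma quotalg_eval_monoid_morphism : monoid_morphism quotalg_eval.
Proof.
split=> [|u w]; first by rewrite quotalg_eval_pi rmorph1.
rewrite -(piK u) -(piK w) -[qpi P _ * _]/(quotalg_mul _ _).
rewrite QuotientAlgebra.pi_mul.
by rewrite !quotalg_eval_pi rmorphM.
Qed.

Lemma quotalg_eval_scalable : scalable quotalg_eval.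
Proof.
move=> k u; rewrite -(piK u) -[k *: _]/(quotalg_scale _ _).
rewrite QuotientAlgebra.pi_scale.
by rewrite !quotalg_eval_pi linearZ.
Qed.

HB.instance Definition _ := GRing.isZmodMorphism.Build (quotalg P) A
  quotalg_eval quotalg_eval_zmod_morphism.
HB.instance Definition _ := GRing.isMonoidMorphism.Build (quotalg P) A
  quotalg_eval quotalg_eval_monoid_morphism.
HB.instance Definition _ := GRing.isScalable.Build R (quotalg P) A *:%R
  quotalg_eval quotalg_eval_scalable.

Lemma quotalg_universal :
  exists f : {lrmorphism quotalg P -> A}, forall u, f (qpi P u) = feval g u.
Proof. by exists quotalg_eval; exact: quotalg_eval_pi. Qed.

End QuotientEvaluation.
End FreeAlgebraEvaluation.

(** The list of relations is natural in the algebra: at [g] it is the image under [feval g] of the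
    list at the free generators. *)
Lemma jacobi2_universal (R : realType) (a b c : R) (A : algType R)
    (g : jacobi2_gen -> A) :
  (forall p, p \in jacobi2_relations a b c g -> p.1 = p.2) ->
  exists f : {lrmorphism jacobi2 a b c -> A},
    forall u, f (qpi _ u) = feval g u.
Proof.
move=> gP; apply: quotalg_universal => p pP.
apply: (gP (feval g p.1, feval g p.2)).
rewrite (@jacobi2_relations_morph _ _ _ _ _ _ (feval g) (@fgen R _)).
  by apply/mapP; exists p.
exact: fevalE.
Qed.

Lemma racah2_universal (R : realType) (A : algType R) (g : racah2_gen -> A) :
  (forall p, p \in racah2_relations g -> p.1 = p.2) ->
  exists f : {lrmorphism racah2 R -> A}, forall u, f (qpi _ u) = feval g u.
Proof.
move=> gP; apply: quotalg_universal => p pP.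
apply: (gP (feval g p.1, feval g p.2)).
rewrite (@racah2_relations_morph _ _ _ (feval g) (@fgen R _)).
  by apply/mapP; exists p.
exact: fevalE.
Qed.

Lemma racah2_of_jacobi2_morph (R : realType) (a b c d : R) (A B : algType R)
    (f : {lrmorphism A -> B}) (g : jacobi2_gen -> A) i :
  racah2_of_jacobi2 a b c d (fun j => f (g j)) i
  = f (racah2_of_jacobi2 a b c d g i).
Proof.
have fE := lrmorphE f.
move: (GRing.LRMorphism.sort f) fE => {}f fE.
by case: i; rewrite /racah2_of_jacobi2 ?fE.
Qed.

(** * Linear independence through principal symbols *)

Lemma com_com_affine (R : comNzRingType) (A : algType R) (I : Type) (r : seq I)
    (k0 : R) (k : I -> R) (u : I -> A) (z : A) :
  com (com (k0%:A + \sum_(i <- r) k i *: u i) z) z =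
  \sum_(i <- r) k i *: com (com (u i) z) z.
Proof.
have comE (w t : A) : com (k0%:A + w) t = com w t.
  by rewrite /com mulrDl mulrDr mulr_algl mulr_algr opprD addrACA subrr add0r.
have com_sum (w : I -> A) (t : A) :
    com (\sum_(i <- r) k i *: w i) t = \sum_(i <- r) k i *: com (w i) t.
  rewrite /com mulr_suml mulr_sumr -sumrB; apply: eq_bigr => i _.
  by rewrite -scalerAl -scalerAr -scalerBr.
by rewrite comE !com_sum.
Qed.

Section LinearIndependence.
Context (R : realType) (a b c d : R).
Local Notation D := (lend (poly2 R)).
Let C : racah2_gen -> D := racah2_of_jacobi2 a b c d (jacobi2_model a b c).
Let X : D := mulop 'X_0.
Let Y : D := mulop 'X_1.

(** Coefficient of [dx ^+ 2] in each generator. Commutators of [C234] with functions have order at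
    most 1, so the second-order part of [C123] is that of [- X1 * C234], and that of [C12] comes
    from [(X3 - 1) * C234 + C34]. *)
Definition dxx_symbol (i : racah2_gen) : poly2 R :=
  let x := 'X_0 in let y := 'X_1 in
  match i with
  | GC12 => (x + y) * x * (1 - x) - x * y
  | GC34 => - (x * y)
  | GC123 => x ^+ 2 * (1 - x)
  | GC234 => - (x * (1 - x))
  | _ => 0
  end.

Definition dyy_symbol (i : racah2_gen) : poly2 R :=
  let x := 'X_0 in let y := 'X_1 in
  match i with
  | GC12 => (x + y) * y * (1 - y) - x * y
  | GC23 => - (y * (1 - x - y))
  | GC34 => - (x * y)
  | GC123 => x * y * (1 - y)
  | GC234 => - (y * (1 - y))
  | _ => 0
  end.

Let rep_C := racah2_model_rep a b c d.

Let rep_X : rep (poly2_family a b c d) X (wvar 4).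
Proof. exact: (@rep_var _ _ _ _ _ 4). Qed.

Let rep_Y : rep (poly2_family a b c d) Y (wvar 5).
Proof. exact: (@rep_var _ _ _ _ _ 5). Qed.

Lemma com_com_X i : com (com (C i) X) X = 2 *: mulop (dxx_symbol i).
Proof.
rewrite scaler_nat -mulr_natl.
by case: i; rewrite /dxx_symbol ?expr2 ?(mulopE, mulop0) -/X -/Y; weyl.
Qed.

Lemma com_com_Y i : com (com (C i) Y) Y = 2 *: mulop (dyy_symbol i).
Proof.
rewrite scaler_nat -mulr_natl.
by case: i; rewrite /dyy_symbol ?(mulopE, mulop0) -/X -/Y; weyl.
Qed.

(** The double commutator with [Z] kills the constant term and turns a relation among the operators
    into one among their symbols; each point of the plane then gives a linear equation in the
    [k i]. *)
Lemma racah2_symbol_sum (Z : D) (symbol : racah2_gen -> poly2 R) k0 k :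
  (forall i, com (com (C i) Z) Z = 2 *: mulop (symbol i)) ->
  k0%:A + \sum_(i <- racah2_noncentral) k i *: C i = 0 ->
  forall x y, \sum_(i <- racah2_noncentral)
    k i * (symbol i).@[fun j : 'I_2 => if j == 0 then x else y] = 0.
Proof.
move=> CZ /(congr1 (fun u => com (com u Z) Z)).
have com0 : com (0 : D) Z = 0 by rewrite /com mul0r mulr0 subr0.
rewrite com_com_affine !com0.
under eq_bigr do rewrite CZ scalerA mulrC -scalerA -mulopZ.
rewrite -scaler_sumr => /eqP; rewrite scaler_eq0 pnatr_eq0 /= => /eqP.
rewrite -(big_morph _ (@mulopD R) (@mulop0 R)) => /(congr1 (fun u : D => u 1)).
rewrite lend0E /= mulr1 => sum0 x y.
move/(congr1 (meval (fun j : 'I_2 => if j == 0 then x else y))): sum0.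
rewrite raddf_sum raddf0 /= => {2}<-.
by apply: eq_bigr => i _; rewrite mevalZ.
Qed.

Lemma racah2_free k0 k :
  k0%:A + \sum_(i <- racah2_noncentral) k i *: C i = 0 ->
  k0 = 0 /\ forall i, i \in racah2_noncentral -> k i = 0.
Proof.
move=> sum0.
have xx := racah2_symbol_sum com_com_X sum0.
have yy := racah2_symbol_sum com_com_Y sum0.
have mE := (mevalD, mevalM, mevalN, meval1, meval0, mevalXU, expr2).
have k_eq0 i : i \in racah2_noncentral -> k i = 0.
  (* The points (2, 0) and (-1, 0) give [k GC234 = 0] and [k GC12 + k GC123 = 0], (1, 1) gives
     [k GC12 + k GC34 = 0], and (2, 1) then forces [k GC12 = 0]. As [C23] has no [dx ^+ 2] term, its
     coefficient is read off the other symbol at (0, 2). *)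
  have := (xx 2 0, xx (-1) 0, xx 1 1, xx 2 1, yy 0 2).
  rewrite !big_cons !big_nil /= !mE /= => -[[[[e1 e2] e3] e4] e5].
  by rewrite !inE => /or4P[|||/orP[]] /eqP ->; lra.
split=> //; move: sum0; rewrite big1_seq => [|i /k_eq0 ->]; last exact: scale0r.
by rewrite addr0 => /eqP; rewrite scaler_eq0 oner_eq0 orbF => /eqP.
Qed.

End LinearIndependence.

Theorem mainTheorem1 (R : realType) (a b c d : R) :
  let J : jacobi2_gen -> lend (poly2 R) := jacobi2_model a b c in
  let C : racah2_gen -> lend (poly2 R) := racah2_of_jacobi2 a b c d J in
  [/\ forall p, p \in jacobi2_relations a b c J -> p.1 = p.2,
      forall p, p \in racah2_relations C -> p.1 = p.2
    & exists (model : {lrmorphism jacobi2 a b c -> lend (poly2 R)})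
             (rho : {lrmorphism racah2 R -> lend (poly2 R)}),
      [/\ forall i, model (jgen a b c i) = J i,
          forall i, rho (rgen R i) = C i,
          forall u, exists v, rho u = model v
        & forall (k0 : R) (k : racah2_gen -> R),
            rho (k0%:A + \sum_(i <- racah2_noncentral) k i *: rgen R i) = 0 ->
            k0 = 0 /\ forall i, i \in racah2_noncentral -> k i = 0]].
Proof.
move=> J C; have JP := @jacobi2_model_relations R a b c.
have CP : forall p, p \in racah2_relations C -> p.1 = p.2.
  exact: racah2_model_relations.
have [model modelE] := jacobi2_universal JP.
have [rho rhoE] := racah2_universal CP.
have model_gen i : model (jgen a b c i) = J i by rewrite modelE fevalE.
have rho_gen i : rho (rgen R i) = C i by rewrite rhoE fevalE.
split=> //; exists model, rho; split=> // [u|k0 k].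
  (* The preimage is the same noncommutative polynomial that represents [u], evaluated in the Jacobi
     algebra at the formulas for the Racah generators; [model] commutes with these formulas. *)
  exists (feval (racah2_of_jacobi2 a b c d (jgen a b c)) (repr u)).
  rewrite -feval_comp -{1}(piK u) rhoE; congr (feval _ _); apply/funext => i.
  by rewrite -racah2_of_jacobi2_morph; congr racah2_of_jacobi2; apply/funext.
rewrite rmorphD /= rmorph_alg raddf_sum /= => sum0.
apply: (@racah2_free _ a b c d); rewrite -[RHS]sum0; congr (_ + _).
by apply: eq_bigr => i _; rewrite linearZ /= rho_gen.
Qed.
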